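(* Let $(c,\theta)\in(-1,0)\times(0,\frac{\pi}{2})$ or $(c,\theta)\in(0,1)\times(\frac{\pi}{2},\pi)$, and let $r>0$ with $r^2+c^2=1$. Let $\mathbf q(c,\theta)=(\mathbf q_1,\dots,\mathbf q_5)\in(\mathbb S^3)^5$ be the configuration $$\mathbf q_1=(0,0,\cos\theta,\sin\theta)^T,\qquad \mathbf q_2=(0,0,\cos\theta,-\sin\theta)^T,$$ $$\mathbf q_3=(r,0,c,0)^T,\quad \mathbf q_4=\left(r\cos\tfrac{2\pi}{3},\,r\sin\tfrac{2\pi}{3},\,c,\,0\right)^T,\quad \mathbf q_5=\left(r\cos\tfrac{4\pi}{3},\,r\sin\tfrac{4\pi}{3},\,c,\,0\right)^T,$$ with masses $m_1=m_2=m$ and $m_3=m_4=m_5=1$. Then $\mathbf q(c,\theta)$ is a central configuration in $\mathbb S^3$ if $$m=-\frac{3c\,|\sin^3 2\theta|}{2\cos\theta\,(1-c^2\cos^2\theta)^{3/2}}.$$ Generally, these central configurations are ordinary central configurations.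
   Context: $\mathbb S^3=\{(x,y,z,w)^T\in\mathbb R^4 : x^2+y^2+z^2+w^2=1\}$ with the metric induced by the Euclidean inner product $\mathbf q_1\cdot\mathbf q_2=x_1x_2+y_1y_2+z_1z_2+w_1w_2$. For positive masses $m_1,\dots,m_N$ at positions $\mathbf q_i=(x_i,y_i,z_i,w_i)^T\in\mathbb S^3$, the configuration is $\mathbf q=(\mathbf q_1,\dots,\mathbf q_N)\in(\mathbb S^3)^N$. The singularity set is $\Delta=\bigcup_{1\le i<j\le N}\{\mathbf q\in(\mathbb S^3)^N : \mathbf q_i\cdot\mathbf q_j=\pm1\}$. The geodesic distance is $d_{ij}=\arccos(\mathbf q_i\cdot\mathbf q_j)$. The force function on $(\mathbb S^3)^N\setminus\Delta$ is $U(\mathbf q)=\sum_{1\le i<j\le N}m_im_j\cot d_{ij}$, and $I(\mathbf q)=\sum_{i=1}^N m_i(x_i^2+y_i^2)$. Let $\nabla_{\mathbf q_i}$ denote the gradient on $\mathbb S^3$ with respect to the $i$-th point $\mathbf q_i$ (the other points fixed). Explicitly, $$\nabla_{\mathbf q_i}U=\sum_{j\ne i}\frac{m_im_j[\mathbf q_j-\cos d_{ij}\,\mathbf q_i]}{\sin^3 d_{ij}},\qquad \nabla_{\mathbf q_i}I=2m_i\big(x_i(w_i^2+z_i^2),\,y_i(w_i^2+z_i^2),\,-z_i(x_i^2+y_i^2),\,-w_i(x_i^2+y_i^2)\big)^T.$$ A configuration $\mathbf q\in(\mathbb S^3)^N\setminus\Delta$ is a central configuration if there is a constant $\lambda$ such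 that $\nabla_{\mathbf q_i}U(\mathbf q)=\lambda\nabla_{\mathbf q_i}I(\mathbf q)$ for all $i=1,\dots,N$. A central configuration with $\lambda=0$ is called special; otherwise it is called ordinary. *)

(* Defs.v *)
From HB Require Import structures.
From mathcomp Require Import all_boot all_order all_algebra.
From mathcomp Require Import all_classical all_reals all_analysis.

Set Implicit Arguments.
Unset Strict Implicit.
Unset Printing Implicit Defensive.

Import Order.TTheory GRing.Theory Num.Theory.
Import numFieldNormedType.Exports.
Local Open Scope classical_set_scope.
Local Open Scope ring_scope.

Definition dot (R : realType) (p q : 'cV[R]_4) : R := \sum_k p k 0 * q k 0.

Definition on_S3 (R : realType) (p : 'cV[R]_4) : Prop := dot p p = 1.

Definition vec4 (R : realType) (x y z w : R) : 'cV[R]_4 :=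
  \col_k nth 0 [:: x; y; z; w] k.

Definition cot (R : realType) (a : R) : R := cos a / sin a.

Definition geodesic_dist (R : realType) (p q : 'cV[R]_4) : R := acos (dot p q).

Definition configuration (R : realType) (N : nat) := 'I_N -> 'cV[R]_4.

Definition singular (R : realType) (N : nat) (q : configuration R N) : Prop :=
  exists i j : 'I_N, (i < j)%N /\ (dot (q i) (q j) = 1 \/ dot (q i) (q j) = -1).

Definition force_function (R : realType) (N : nat) (m : 'I_N -> R)
    (q : configuration R N) : R :=
  \sum_(i < N) \sum_(j < N | (i < j)%N)
    m i * m j * cot (geodesic_dist (q i) (q j)).

Definition inertia (R : realType) (N : nat) (m : 'I_N -> R)
    (q : configuration R N) : R :=
  \sum_(i < N) m i * (q i 0 0 ^+ 2 + q i 1 0 ^+ 2).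

(* g is the Riemannian gradient at p of f restricted to the unit sphere: the
   tangent vector g at p such that df_p(v) = g . v for every tangent vector v,
   tangent vectors being the velocities of curves on the sphere through p. *)
Definition is_sphere_gradient (R : realType) (f : 'cV[R]_4 -> R)
    (p g : 'cV[R]_4) : Prop :=
  dot g p = 0 /\
  forall (gamma : R -> 'cV[R]_4) (v : 'cV[R]_4),
    (forall t, on_S3 (gamma t)) -> gamma 0 = p ->
    is_derive (0 : R) (1 : R) gamma v ->
    is_derive (0 : R) (1 : R) (f \o gamma) (dot g v).

Definition move_point (R : realType) (N : nat) (q : configuration R N)
    (i : 'I_N) (x : 'cV[R]_4) : configuration R N :=
  fun j => if j == i then x else q j.

Definition is_partial_gradient (R : realType) (N : nat)
    (F : configuration R N -> R) (q : configuration R N) (i : 'I_N)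
    (g : 'cV[R]_4) : Prop :=
  is_sphere_gradient (fun x => F (move_point q i x)) (q i) g.

Definition central_with (R : realType) (N : nat) (m : 'I_N -> R)
    (q : configuration R N) (lambda : R) : Prop :=
  [/\ forall i, 0 < m i,
      forall i, on_S3 (q i),
      ~ singular q &
      forall i, exists gU gI : 'cV[R]_4,
        [/\ is_partial_gradient (force_function m) q i gU,
            is_partial_gradient (inertia m) q i gI &
            gU = lambda *: gI]].

Definition central_configuration (R : realType) (N : nat) (m : 'I_N -> R)
    (q : configuration R N) : Prop :=
  exists lambda, central_with m q lambda.

Definition special_central_configuration (R : realType) (N : nat)
    (m : 'I_N -> R) (q : configuration R N) : Prop :=
  central_with m q 0.

Definition ordinary_central_configuration (R : realType) (N : nat)
    (m : 'I_N -> R) (q : configuration R N) : Prop :=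
  central_configuration m q /\ ~ special_central_configuration m q.

Definition five_points (R : realType) (r c theta : R) : configuration R 5 :=
  fun i => nth 0 [::
    vec4 0 0 (cos theta) (sin theta);
    vec4 0 0 (cos theta) (- sin theta);
    vec4 r 0 c 0;
    vec4 (r * cos (2 * pi / 3)) (r * sin (2 * pi / 3)) c 0;
    vec4 (r * cos (4 * pi / 3)) (r * sin (4 * pi / 3)) c 0] i.

Definition five_masses (R : realType) (m : R) : 'I_5 -> R :=
  fun i => nth 0 [:: m; m; 1; 1; 1] i.

Definition admissible (R : realType) : set (R * R) :=
  [set p | (-1 < p.1 < 0 /\ 0 < p.2 < pi / 2) \/
           (0 < p.1 < 1 /\ pi / 2 < p.2 < pi)].
Arguments admissible : clear implicits.

Definition balancing_mass (R : realType) (c theta : R) : R :=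
  - (3 * c * `|sin (2 * theta) ^+ 3|
     / (2 * cos theta * (1 - c ^+ 2 * cos theta ^+ 2) `^ (3 / 2))).

(* A property Q of the parameters holds for generic p in the region D: it holds
   on an open dense subset of D of full Lebesgue measure.  With D open, [open]
   in the plane is the same as open relative to D. *)
Definition generically_in (R : realType) (D Q : set (R * R)) : Prop :=
  [/\ open (D `&` Q),
      D `<=` closure (D `&` Q) &
      (@lebesgue_measure R \x @lebesgue_measure R)%E.-negligible (D `\` Q)].

(* Main.v *)
(** With [phi(u) = cot (acos u)] and [phi'(u) = (1 - u^2)^(-3/2)], the force
    gradient at [q_i] is the sum over [j] of
    [m_i m_j phi'(q_i . q_j) (q_j - (q_i . q_j) q_i)].  Since
    [q_1 + q_2 = 2 cos theta e_z] and [q_3 + q_4 + q_5 = 3 c e_z], it is a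
    multiple of the projection of [e_z] onto the tangent space at [q_i].  At
    [q_1] and [q_2] the gradient of the inertia vanishes, and the balancing mass
    is exactly the one cancelling the force; at [q_3], [q_4], [q_5] the gradient
    of the inertia is a multiple of the same vector, with coefficient
    [- 2 c <> 0], so lambda exists.

    The central configuration is special iff the coefficient at [q_3] vanishes,
    which is an equation polynomial in [c] and [cos theta].  For fixed [c] this
    polynomial in [cos theta] is [-1] at [0], so it has finitely many roots: the
    exceptional set is closed with finite vertical sections, hence negligible
    with dense complement. *)

Require Import Defs.
From HB Require Import structures.
From mathcomp Require Import all_boot all_order all_algebra.
From mathcomp Require Import all_classical all_reals all_analysis.
From mathcomp Require Import measurable_realfun ring lra.

Set Implicit Arguments.
Unset Strict Implicit.
Unset Printing Implicit Defensive.

Import Order.TTheory GRing.Theory Num.Theory.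
Import numFieldNormedType.Exports.
Local Open Scope classical_set_scope.
Local Open Scope ring_scope.

(** * The inner product on four-space *)

Lemma dotE (R : realType) (p q : 'cV[R]_4) :
  dot p q = p 0 0 * q 0 0 + p 1 0 * q 1 0 + p 2 0 * q 2 0 + p 3 0 * q 3 0.
Proof.
rewrite /dot !big_ord_recl big_ord0 addr0 !addrA.
by do !congr (_ + _); do !congr (_ * _); congr (_ _ _); apply/val_inj.
Qed.

Lemma dotC (R : realType) (p q : 'cV[R]_4) : dot p q = dot q p.
Proof. by apply: eq_bigr => k _; rewrite mulrC. Qed.

Lemma dotDl (R : realType) (p q s : 'cV[R]_4) :
  dot (p + q) s = dot p s + dot q s.
Proof. by rewrite -big_split; apply: eq_bigr => k _; rewrite mxE mulrDl. Qed.

Lemma dotZl (R : realType) (a : R) (p q : 'cV[R]_4) :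
  dot (a *: p) q = a * dot p q.
Proof. by rewrite /dot mulr_sumr; apply: eq_bigr => k _; rewrite mxE mulrA. Qed.

Lemma dotBl (R : realType) (p q s : 'cV[R]_4) :
  dot (p - q) s = dot p s - dot q s.
Proof. by rewrite dotDl -scaleN1r dotZl mulN1r. Qed.

Lemma dot_suml (R : realType) (I : finType) (P : pred I) (F : I -> 'cV[R]_4)
    (q : 'cV[R]_4) :
  dot (\sum_(i | P i) F i) q = \sum_(i | P i) dot (F i) q.
Proof.
apply: (big_morph (fun p => dot p q)) => [x y|]; first exact: dotDl.
by rewrite /dot big1 // => k _; rewrite mxE mul0r.
Qed.

(** * Derivatives of curves in four-space *)

Lemma is_derive_entry (R : realType) (m n : nat) (M : R -> 'M[R]_(m, n))
    (t : R) (v : 'M[R]_(m, n)) i j :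
  is_derive t (1 : R) M v -> is_derive t (1 : R) (fun s => M s i j) (v i j).
Proof.
move=> [dM DM]; apply: DeriveDef; first by move/derivable_mxP: dM; apply.
by rewrite -DM derive_mx // mxE.
Qed.

Lemma is_derive_mx (R : realType) (m n : nat) (M : R -> 'M[R]_(m, n))
    (t : R) (v : 'M[R]_(m, n)) :
  (forall i j, is_derive t (1 : R) (fun s => M s i j) (v i j)) ->
  is_derive t (1 : R) M v.
Proof.
move=> dM.
have dM' : derivable M t 1 by apply/derivable_mxP => i j; case: (dM i j).
apply: DeriveDef => //; rewrite derive_mx //.
by apply/matrixP => i j; rewrite mxE; case: (dM i j).
Qed.

Lemma is_derive_sum_fun (R : realType) (I : finType) (P : pred I)
    (h : I -> R -> R) (dh : I -> R) (t : R) :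
  (forall i, P i -> is_derive t (1 : R) (h i) (dh i)) ->
  is_derive t (1 : R) (fun s => \sum_(i | P i) h i s) (\sum_(i | P i) dh i).
Proof.
move=> dhP; pose Q (f : R -> R) (d : R) := is_derive t (1 : R) f d.
have: Q (\sum_(i | P i) h i) (\sum_(i | P i) dh i).
  apply: (big_ind2 Q) => [|f1 d1 f2 d2|i Pi].
  - exact: is_derive_cst.
  - exact: is_deriveD.
  - exact: dhP.
by rewrite /Q fct_sumE.
Qed.

Lemma is_derive_dot (R : realType) (f g : R -> 'cV[R]_4) (t : R)
    (df dg : 'cV[R]_4) :
  is_derive t (1 : R) f df -> is_derive t (1 : R) g dg ->
  is_derive t (1 : R) (fun s => dot (f s) (g s)) (dot df (g t) + dot (f t) dg).
Proof.
move=> hf hg; rewrite -big_split.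
apply: is_derive_sum_fun => k _.
have [hfk hgk] := (is_derive_entry k 0 hf, is_derive_entry k 0 hg).
by apply: is_derive_eq (is_deriveM hfk hgk) _; rewrite /GRing.scale /=; ring.
Qed.

(** Differentiating the constant [dot (gamma s) (gamma s) = 1] shows that twice this product is
    zero. *)
Lemma velocity_orthogonal (R : realType) (gamma : R -> 'cV[R]_4) (t : R)
    (v : 'cV[R]_4) :
  (forall s, on_S3 (gamma s)) -> is_derive t (1 : R) gamma v ->
  dot (gamma t) v = 0.
Proof.
move=> S3 dg; have [_ D] := is_derive_dot dg dg.
have e : (fun s => dot (gamma s) (gamma s)) = cst 1 by apply/funext => s; exact: S3.
move: D; rewrite e derive_cst (dotC v) => /esym/eqP.
by rewrite -mulr2n mulrn_eq0 /= => /eqP.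
Qed.

(** * Gradients of the force function and of the inertia *)

(** At [u = cos d] with [d] strictly between 0 and pi this is [1 / sin^3 d], the weight of a pair of
    unit masses in the force. *)
Definition attraction (R : realType) (u : R) : R := Num.sqrt (1 - u ^+ 2) ^- 3.

Lemma is_derive_cot_acos (R : realType) (u : R) : -1 < u < 1 ->
  is_derive u (1 : R) (fun x => cot (acos x)) (attraction u).
Proof.
move=> u1; have u1' : -1 <= u <= 1 by case/andP: u1 => *; rewrite !ltW.
have s0 : 0 < 1 - u ^+ 2 by nra.
have sq0 : 0 < Num.sqrt (1 - u ^+ 2) by rewrite sqrtr_gt0.
have sE := sin_acos u1'.
have cE : cos (acos u) = u by rewrite acosK // in_itv.
have hs : sin (acos u) != 0 by rewrite sE gt_eqF.
have da := is_derive1_acos u1.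
have dcot : is_derive (acos u) (1 : R) (@cot R) (- (sin (acos u)) ^- 2).
  have dV := is_deriveV hs (is_derive_sin (acos u)).
  apply: is_derive_eq (is_deriveM (is_derive_cos (acos u)) dV) _.
  rewrite /GRing.scale /= -[RHS]mul1r -(cos2Dsin2 (acos u)); field.
  by rewrite hs.
apply: is_derive_eq (is_derive1_comp dcot da) _.
by rewrite /attraction sE; field; exact: lt0r_neq0.
Qed.

(** Only the pairs containing [i] depend on the position of body [i]; the first sum on the right
    stays constant when that body moves. *)
Lemma sum_lt_isolate (V : nmodType) (N : nat) (G : 'I_N -> 'I_N -> V) (i : 'I_N) :
  (forall a b, G a b = G b a) ->
  \sum_(a < N) \sum_(b < N | (a < b)%N) G a b =
  \sum_(a < N | a != i) \sum_(b < N | (a < b)%N && (b != i)) G a b +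
  \sum_(j < N | j != i) G i j.
Proof.
move=> Gsym; rewrite (bigD1 i) //= addrC.
(* A row [a] other than [i] contains the pair [(a, i)] exactly when [a < i]; symmetry turns it into
   [(i, a)]. *)
have -> : \sum_(a < N | a != i) \sum_(b < N | (a < b)%N) G a b =
  \sum_(a < N | a != i) \sum_(b < N | (a < b)%N && (b != i)) G a b +
  \sum_(a < N | (a < i)%N) G i a.
  have -> : \sum_(a : 'I_N | (a < i)%N) G i a =
            \sum_(a | a != i) (if (a < i)%N then G i a else 0).
    rewrite -big_mkcondr; apply: eq_bigl => a.
    by rewrite -val_eqE /=; case: ltngtP.
  rewrite -big_split; apply: eq_bigr => a ai /=.
  case: ifP => [lt_ai|nlt_ai]; first by rewrite (bigD1 i) //= addrC Gsym.
  rewrite addr0; apply: eq_bigl => b.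
  by case: eqVneq => [->|]; rewrite ?nlt_ai ?andbT.
rewrite -addrA; congr (_ + _).
rewrite [RHS](bigID (fun j : 'I_N => (j < i)%N)) /=; congr (_ + _);
  by apply: eq_bigl => j; rewrite -val_eqE /=; case: ltngtP.
Qed.

Lemma force_function_move (R : realType) (N : nat) (m : 'I_N -> R)
    (q : configuration R N) (i : 'I_N) (x : 'cV[R]_4) :
  force_function m (move_point q i x) =
  \sum_(a < N | a != i) \sum_(b < N | (a < b)%N && (b != i))
     m a * m b * cot (geodesic_dist (q a) (q b)) +
  \sum_(j < N | j != i) m i * m j * cot (acos (dot x (q j))).
Proof.
rewrite /force_function (@sum_lt_isolate _ _ _ i); last first.
  by move=> a b; rewrite (mulrC (m a)) /geodesic_dist dotC.
congr (_ + _).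
  apply: eq_bigr => a ai; apply: eq_bigr => b /andP[_ bi].
  by rewrite /move_point (negPf ai) (negPf bi).
by apply: eq_bigr => j ji; rewrite /move_point eqxx (negPf ji).
Qed.

Definition force_gradient (R : realType) (N : nat) (m : 'I_N -> R)
    (q : configuration R N) (i : 'I_N) : 'cV[R]_4 :=
  \sum_(j < N | j != i) (m i * m j * attraction (dot (q i) (q j))) *:
    (q j - dot (q i) (q j) *: q i).

(** Along a curve with velocity [v], each [cot] term contributes a multiple of [dot v (q j)].
    Projecting [q j] onto the tangent space at [q i] makes the gradient tangent and keeps this
    product, because [v] is orthogonal to [q i]. *)
Lemma force_gradientP (R : realType) (N : nat) (m : 'I_N -> R)
    (q : configuration R N) (i : 'I_N) :
  on_S3 (q i) -> (forall j, j != i -> -1 < dot (q i) (q j) < 1) ->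
  is_partial_gradient (force_function m) q i (force_gradient m q i).
Proof.
move=> qi1 qij; split.
  rewrite dot_suml big1 // => j _.
  by rewrite dotZl dotBl dotZl qi1 (dotC (q j)) mulr1 subrr mulr0.
move=> gamma v S3 g0 dg.
have qv : dot (q i) v = 0 by rewrite -g0; exact: velocity_orthogonal dg.
have -> : (fun x => force_function m (move_point q i x)) \o gamma =
  cst (\sum_(a < N | a != i) \sum_(b < N | (a < b)%N && (b != i))
         m a * m b * cot (geodesic_dist (q a) (q b))) \+
  (fun t => \sum_(j < N | j != i) m i * m j * cot (acos (dot (gamma t) (q j)))).
  by apply/funext => t /=; rewrite force_function_move.
rewrite dot_suml -[X in is_derive _ _ _ X]add0r; apply: is_deriveD.
apply: is_derive_sum_fun => j ji.
have du : is_derive (0 : R) (1 : R) (fun t => dot (gamma t) (q j)) (dot v (q j)).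
  have dc := is_derive_cst (q j) (0 : R) (1 : R).
  have := is_derive_dot dg dc; move=> /is_derive_eq; apply.
  rewrite [X in _ + X]dotC /dot [X in _ + X]big1 ?addr0 // => k _.
  by rewrite mxE mul0r.
have gj : -1 < dot (gamma 0) (q j) < 1 by rewrite g0; exact: qij.
have := is_deriveZ (m i * m j) (is_derive1_comp (is_derive_cot_acos gj) du).
move=> /is_derive_eq; apply.
by rewrite g0 dotZl dotBl dotZl qv mulr0 subr0 (dotC v) /GRing.scale /= mulrA.
Qed.

(** The ambient gradient [2 m (x, y, 0, 0)] projected onto the tangent space. On the sphere
    [1 - x^2 - y^2 = z^2 + w^2], which gives the coordinate form with entries such as
    [2 m x (w^2 + z^2)]. *)
Definition inertia_gradient (R : realType) (N : nat) (m : 'I_N -> R)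
    (q : configuration R N) (i : 'I_N) : 'cV[R]_4 :=
  (2 * m i) *: (vec4 (q i 0 0) (q i 1 0) 0 0 -
                (q i 0 0 ^+ 2 + q i 1 0 ^+ 2) *: q i).

Lemma dot_vec4 (R : realType) (x y z w : R) (p : 'cV[R]_4) :
  dot (vec4 x y z w) p = x * p 0 0 + y * p 1 0 + z * p 2 0 + w * p 3 0.
Proof. by rewrite dotE !mxE. Qed.

Lemma inertia_gradientP (R : realType) (N : nat) (m : 'I_N -> R)
    (q : configuration R N) (i : 'I_N) : on_S3 (q i) ->
  is_partial_gradient (inertia m) q i (inertia_gradient m q i).
Proof.
move=> qi1; split.
  by rewrite dotZl dotBl dotZl qi1 dot_vec4; ring.
move=> gamma v S3 g0 dg.
have qv : dot (q i) v = 0 by rewrite -g0; exact: velocity_orthogonal dg.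
pose K := \sum_(a < N | a != i) m a * (q a 0 0 ^+ 2 + q a 1 0 ^+ 2).
have -> : (fun x => inertia m (move_point q i x)) \o gamma =
  cst K + m i \*: ((fun t => gamma t 0 0) ^+ 2 + (fun t => gamma t 1 0) ^+ 2).
  apply/funext => t; rewrite /inertia /= (bigD1 i) //= addrC.
  congr (_ + _); last by rewrite /move_point eqxx.
  by apply: eq_bigr => a ai; rewrite /move_point (negPf ai).
have d0 := is_derive_entry 0 0 dg; have d1 := is_derive_entry 1 0 dg.
have dF := is_deriveZ (m i) (is_deriveD (is_deriveX 2 d0) (is_deriveX 2 d1)).
have := is_deriveD (is_derive_cst K (0 : R) (1 : R)) dF.
move=> /is_derive_eq; apply.
rewrite dotZl dotBl dotZl qv mulr0 subr0 dot_vec4 g0 /GRing.scale /=; ring.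
Qed.

(** The self-term carries the vector [q i - q i = 0], so it can be included; the sum then runs over
    the same indices for every [i]. *)
Lemma force_gradientE (R : realType) (N : nat) (m : 'I_N -> R)
    (q : configuration R N) (i : 'I_N) : on_S3 (q i) ->
  force_gradient m q i =
  \sum_j (m i * m j * attraction (dot (q i) (q j))) *:
    (q j - dot (q i) (q j) *: q i).
Proof.
by move=> qi1; rewrite [RHS](bigD1 i) //= qi1 scale1r subrr scaler0 add0r.
Qed.

(** * Uniqueness of the gradient on the sphere *)

Lemma is_derive_great_circle (R : realType) (p v : 'cV[R]_4) :
  is_derive (0 : R) (1 : R) (fun t => cos t *: p + sin t *: v) v.
Proof.
apply: is_derive_mx => i j.
have -> : (fun t => (cos t *: p + sin t *: v) i j) =
          p i j \*: (@cos R : R -> R) + v i j \*: (@sin R : R -> R).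
  by apply/funext => t; rewrite !mxE; congr (_ + _); exact: mulrC.
have dc := is_deriveZ (p i j) (is_derive_cos (0 : R)).
have ds := is_deriveZ (v i j) (is_derive_sin (0 : R)).
move: (is_deriveD dc ds) => /is_derive_eq; apply.
by rewrite /GRing.scale /= sin0 cos0; ring.
Qed.

(* The great circle through [p] in the direction of [g - h] separates two
   different candidates. *)
Lemma sphere_gradient_unique (R : realType) (f : 'cV[R]_4 -> R)
    (p g h : 'cV[R]_4) : on_S3 p ->
  is_sphere_gradient f p g -> is_sphere_gradient f p h -> g = h.
Proof.
move=> p1 [gp gP] [hp hP].
have eq_dot v : dot v v = 1 -> dot p v = 0 -> dot g v = dot h v.
  move=> v1 pv; pose gamma t := cos t *: p + sin t *: v.
  have S3 t : on_S3 (gamma t).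
    rewrite /on_S3 /gamma dotDl !dotZl (dotC p) (dotC v) !dotDl !dotZl.
    by rewrite p1 v1 (dotC v) pv -[RHS](cos2Dsin2 t); ring.
  have g0 : gamma 0 = p by rewrite /gamma cos0 sin0 scale0r addr0 scale1r.
  have dg := is_derive_great_circle p v.
  by case: (gP _ _ S3 g0 dg) => _ <-; case: (hP _ _ S3 g0 dg) => _ <-.
apply/eqP; rewrite -subr_eq0; apply/eqP; set w := g - h.
have wp : dot p w = 0 by rewrite dotC dotBl gp hp subrr.
have w_ge0 k : 0 <= w k 0 * w k 0 by rewrite -expr2 sqr_ge0.
have [w0|w0] := eqVneq (dot w w) 0.
  apply/colP => k; rewrite [RHS]mxE; apply/eqP; rewrite -[_ == 0]orbb -mulf_eq0.
  move: w0 => /eqP; rewrite psumr_eq0 => [/allP/(_ k)|//]; apply.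
  exact: mem_index_enum.
have w_gt0 : 0 < dot w w by rewrite lt_def w0 sumr_ge0.
(* Normalising [w] gives an admissible unit direction; equality of the two products there forces
   [dot w w = 0]. *)
pose s := Num.sqrt (dot w w).
have s0 : s != 0 by rewrite gt_eqF // sqrtr_gt0.
have dotsw x : dot x (s^-1 *: w) = s^-1 * dot x w by rewrite dotC dotZl dotC.
have := eq_dot (s^-1 *: w); rewrite !dotsw dotZl wp mulr0 mulrA -invfM -expr2.
rewrite sqr_sqrtr ?ltW // mulVf // => /(_ erefl erefl) /(mulfI (invr_neq0 s0)).
by move=> /eqP; rewrite -subr_eq0 -dotBl (negPf w0).
Qed.

(** * Trigonometric values for the equilateral triangle *)

Lemma cos_pi3 (R : realType) : cos (pi / 3) = 1 / 2 :> R.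
Proof.
have p0 := pi_gt0 R.
(* The sign excludes the root -1 of the cubic below. *)
have c0 : 0 < cos (pi / 3) :> R by apply: cos_gt0_pihalf; apply/andP; split; lra.
have : cos (pi / 3 + (pi / 3 + pi / 3)) = -1 :> R.
  by rewrite -[RHS](@cospi R); congr cos; lra.
rewrite !cosD !sinD; have := cos2Dsin2 (pi / 3 : R).
set c := cos (pi / 3) in c0 *; set s := sin (pi / 3) => cs h.
(* the triple-angle equation [4 c^3 - 3 c = -1], factored *)
have : (c + 1) * (2 * c - 1) ^+ 2 = 0.
  have cs2 : c * s ^+ 2 = c - c ^+ 3 by rewrite -[X in X - _]mulr1 -cs; ring.
  by lra.
move=> /eqP; rewrite mulf_eq0 sqrf_eq0 => /orP[]/eqP; lra.
Qed.

Lemma cos_2pi3 (R : realType) : cos (2 * pi / 3) = - (1 / 2) :> R.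
Proof.
have -> : 2 * pi / 3 = pi / 3 + pi / 3 :> R by field.
rewrite cosD -!expr2 sin2cos2 cos_pi3; lra.
Qed.

Lemma sin_2pi3_sqr (R : realType) : sin (2 * pi / 3) ^+ 2 = 3 / 4 :> R.
Proof. rewrite sin2cos2 cos_2pi3; lra. Qed.

Lemma cos_4pi3 (R : realType) : cos (4 * pi / 3) = - (1 / 2) :> R.
Proof.
have -> : 4 * pi / 3 = 2 * pi / 3 + 2 * pi / 3 :> R by field.
rewrite cosD -!expr2 sin_2pi3_sqr cos_2pi3; lra.
Qed.

Lemma sin_4pi3 (R : realType) : sin (4 * pi / 3) = - sin (2 * pi / 3) :> R.
Proof.
have -> : 4 * pi / 3 = 2 * pi / 3 + 2 * pi / 3 :> R by field.
rewrite sinD cos_2pi3; lra.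
Qed.

(** * Products and gradients for the five points *)

(** There are three distances: [cos d_12 = cos (2 theta)], [cos d_13 = c cos theta], and
    [cos d_34 = c^2 - r^2 / 2]. *)
Lemma dot_five_points (R : realType) (r c theta : R) (i j : 'I_5) :
  r ^+ 2 + c ^+ 2 = 1 ->
  dot (five_points r c theta i) (five_points r c theta j) =
  if i == j then 1 else
  if (i < 2)%N && (j < 2)%N then 2 * cos theta ^+ 2 - 1 else
  if (i < 2)%N || (j < 2)%N then c * cos theta else (3 * c ^+ 2 - 1) / 2.
Proof.
move=> rc; have h2 := sin_2pi3_sqr R; have cs := cos2Dsin2 theta.
(* [lra] treats monomials as atoms, so the value of the squared sine is also supplied multiplied by
   [r ^+ 2]. *)
have rh2 : r ^+ 2 * sin (2 * pi / 3) ^+ 2 = r ^+ 2 * (3 / 4) by rewrite h2.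
case: i => -[|[|[|[|[|//]]]]] ?; case: j => -[|[|[|[|[|//]]]]] ?;
  rewrite /five_points /= dot_vec4 !mxE /= ?cos_2pi3 ?cos_4pi3 ?sin_4pi3;
  move: h2 rh2 rc cs; set h := sin _; set C := cos theta; set S := sin theta;
  move=> h2 rh2 rc cs; lra.
Qed.

(** Up to the factor [m], the coefficient of the force at [q_1] and [q_2] along the projected
    z-axis: first the part due to the pair, then the part due to the triangle. *)
Definition pole_coeff (R : realType) (c theta m : R) : R :=
  2 * m * cos theta * attraction (2 * cos theta ^+ 2 - 1) +
  3 * c * attraction (c * cos theta).

(** The corresponding coefficient at a vertex of the triangle. *)
Definition ring_coeff (R : realType) (c theta m : R) : R :=
  2 * m * cos theta * attraction (c * cos theta) +
  3 * c * attraction ((3 * c ^+ 2 - 1) / 2).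

Lemma on_S3_five_points (R : realType) (r c theta : R) (i : 'I_5) :
  r ^+ 2 + c ^+ 2 = 1 -> on_S3 (five_points r c theta i).
Proof. by move=> rc; rewrite /on_S3 dot_five_points // eqxx. Qed.

(** Each point has zero projection onto its own tangent space, so it can be counted with the weight
    of the others in its group. The groups then sum to [2 cos theta e_z] and [3 c e_z]. *)
Lemma force_gradient_five (R : realType) (r c theta m : R) (i : 'I_5) :
  r ^+ 2 + c ^+ 2 = 1 ->
  force_gradient (five_masses m) (five_points r c theta) i =
  if (i < 2)%N
  then (m * pole_coeff c theta m) *:
       (vec4 0 0 1 0 - cos theta *: five_points r c theta i)
  else ring_coeff c theta m *:
       (vec4 0 0 1 0 - c *: five_points r c theta i).
Proof.
move=> rc; rewrite force_gradientE; last exact: on_S3_five_points.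
under eq_bigr => j _ do rewrite dot_five_points //.
rewrite !big_ord_recl big_ord0 /pole_coeff /ring_coeff.
case: i => -[|[|[|[|[|//]]]]] ?; rewrite /five_points /five_masses /=;
  apply/colP => -[[|[|[|[|//]]]] ?]; rewrite !mxE /=
    ?cos_2pi3 ?cos_4pi3 ?sin_4pi3; by field.
Qed.

(** The first two points have [x = y = 0]. At a vertex [q] of the triangle,
    [(x, y, 0, 0) = q - c e_z] and [x^2 + y^2 = 1 - c^2], so the projection is [- c (e_z - c q)]. *)
Lemma inertia_gradient_five (R : realType) (r c theta m : R) (i : 'I_5) :
  r ^+ 2 + c ^+ 2 = 1 ->
  inertia_gradient (five_masses m) (five_points r c theta) i =
  if (i < 2)%N then 0
  else (- (2 * c)) *: (vec4 0 0 1 0 - c *: five_points r c theta i).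
Proof.
move=> rc; have h2 := sin_2pi3_sqr R.
have rE : r ^+ 2 = 1 - c ^+ 2 by rewrite -rc addrK.
have rh2 : (r * sin (2 * pi / 3)) ^+ 2 = (1 - c ^+ 2) * (3 / 4).
  by rewrite exprMn h2 rE.
rewrite /inertia_gradient /five_points /five_masses.
case: i => -[|[|[|[|[|//]]]]] ? /=;
  apply/colP => -[[|[|[|[|//]]]] ?]; rewrite !mxE /=
    ?cos_2pi3 ?cos_4pi3 ?sin_4pi3 ?mulrN ?sqrrN ?rh2 ?exprMn ?rE; by field.
Qed.

(* The square of [|sin 2 theta| sin d_34 = sin^2 d_13], the condition for the
   forces on [q_3] to balance once the mass is the balancing mass. *)
Definition resonance (R : realType) (c theta : R) : R :=
  3 * cos theta ^+ 2 * (1 - cos theta ^+ 2) * (1 - c ^+ 2) * (1 + 3 * c ^+ 2) -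
  (1 - c ^+ 2 * cos theta ^+ 2) ^+ 2.

(** * Admissible parameters and the balancing mass *)

(** On both components of the domain [c] and [cos theta] have opposite signs, which is what makes
    the mass positive. *)
Lemma admissible_bounds (R : realType) (c theta : R) :
  admissible R (c, theta) ->
  [/\ c * cos theta < 0, 0 < theta < pi, 0 < sin theta & c ^+ 2 < 1].
Proof.
have p0 := pi_gt0 R; case=> -[/= /andP[c1 c2] /andP[t1 t2]].
- have t0pi : 0 < theta < pi by apply/andP; split; lra.
  split => //; [|exact: sin_gt0_pi|nra].
  by rewrite nmulr_rlt0 //; apply: cos_gt0_pihalf; apply/andP; split; lra.
- have t0pi : 0 < theta < pi by apply/andP; split; lra.
  split => //; [|exact: sin_gt0_pi|nra].
  rewrite pmulr_rlt0 // -(subrK (pi / 2) theta) cosDpihalf oppr_lt0.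
  by apply: sin_gt0_pi; apply/andP; split; lra.
Qed.

Lemma admissible_neq0 (R : realType) (c theta : R) :
  admissible R (c, theta) -> c != 0 /\ cos theta != 0.
Proof.
move=> /admissible_bounds[cC _ _ _]; split; apply: contraTneq cC => ->.
  by rewrite mul0r ltxx.
by rewrite mulr0 ltxx.
Qed.

Lemma sin_double (R : realType) (x : R) : sin (2 * x) = 2 * (cos x * sin x).
Proof. by rewrite !mulr_natl sin_mulr2n. Qed.

(** This is [sin d_12], as [cos d_12 = cos (2 theta)]. *)
Lemma sqrt_pole (R : realType) (theta : R) :
  Num.sqrt (1 - (2 * cos theta ^+ 2 - 1) ^+ 2) = `|sin (2 * theta)|.
Proof.
rewrite -sqrtr_sqr sin_double !exprMn sin2cos2.
by congr Num.sqrt; ring.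
Qed.

(** Splitting the exponent [3 / 2] as [1/2 * 3] turns the real power into a cube of a square root,
    the form used by [attraction]. *)
Lemma balancing_massE (R : realType) (c theta : R) :
  0 <= 1 - c ^+ 2 * cos theta ^+ 2 ->
  balancing_mass c theta = - (3 * c * `|sin (2 * theta)| ^+ 3 /
    (2 * cos theta * Num.sqrt (1 - (c * cos theta) ^+ 2) ^+ 3)).
Proof.
move=> h; rewrite /balancing_mass normrX exprMn.
have -> : 3 / 2 = 2^-1 * 3%:R :> R by rewrite mulrC.
by rewrite powRrM powR12_sqrt // powR_mulrn // sqrtr_ge0.
Qed.

Lemma balancing_mass_gt0 (R : realType) (c theta : R) :
  admissible R (c, theta) -> 0 < balancing_mass c theta.
Proof.
move=> adm; have [_ C0] := admissible_neq0 adm.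
have [cC _ s0 c1] := admissible_bounds adm.
have C1 : cos theta ^+ 2 <= 1 by rewrite cos2sin2 gerBl sqr_ge0.
have a0 : 0 < 1 - (c * cos theta) ^+ 2 by rewrite exprMn; nra.
rewrite balancing_massE -?exprMn ?ltW //.
have sq0 : 0 < Num.sqrt (1 - (c * cos theta) ^+ 2) by rewrite sqrtr_gt0.
have w0 : 0 < `|sin (2 * theta)|.
  by rewrite normr_gt0 sin_double !mulf_neq0 // gt_eqF.
have C2 : 0 < cos theta ^+ 2 by rewrite exprn_even_gt0.
(* Expanding the fraction by [cos theta] leaves the sign to [- c cos theta]. *)
have -> : - (3 * c * `|sin (2 * theta)| ^+ 3 /
    (2 * cos theta * Num.sqrt (1 - (c * cos theta) ^+ 2) ^+ 3)) =
  3 / 2 * (- (c * cos theta)) * `|sin (2 * theta)| ^+ 3 /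
   (cos theta ^+ 2 * Num.sqrt (1 - (c * cos theta) ^+ 2) ^+ 3).
  by field; rewrite C0 gt_eqF.
have num0 : 0 < 3 / 2 * - (c * cos theta) by rewrite mulr_gt0 ?oppr_gt0 ?divr_gt0.
by rewrite divr_gt0 // mulr_gt0 // exprn_gt0.
Qed.

Lemma pole_coeff_balanced (R : realType) (c theta : R) :
  admissible R (c, theta) -> pole_coeff c theta (balancing_mass c theta) = 0.
Proof.
move=> adm; have [_ C0] := admissible_neq0 adm.
have [cC _ s0 c1] := admissible_bounds adm.
have C1 : cos theta ^+ 2 <= 1 by rewrite cos2sin2 gerBl sqr_ge0.
have a0 : 0 < 1 - (c * cos theta) ^+ 2 by rewrite exprMn; nra.
have sq0 : Num.sqrt (1 - (c * cos theta) ^+ 2) != 0 by rewrite gt_eqF // sqrtr_gt0.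
have w0 : `|sin (2 * theta)| != 0.
  by rewrite normr_eq0 sin_double !mulf_neq0 // gt_eqF.
rewrite /pole_coeff balancing_massE -?exprMn ?ltW // /attraction sqrt_pole.
by field; rewrite C0 w0 sq0.
Qed.

(** With [w = |sin 2 theta|], [a = sin d_13] and [b = sin d_34], the coefficient is a nonzero
    multiple of [a^6 - (w b)^3]. Cubing and squaring are injective on nonnegative reals, so it
    vanishes iff [(w b)^2 = a^4], which is polynomial in [c] and [cos theta]. *)
Lemma ring_coeff_balanced (R : realType) (c theta : R) :
  admissible R (c, theta) ->
  (ring_coeff c theta (balancing_mass c theta) == 0) = (resonance c theta == 0).
Proof.
move=> adm; have [c0 C0] := admissible_neq0 adm.
have [cC _ s0 c1] := admissible_bounds adm.
have C1 : cos theta ^+ 2 <= 1 by rewrite cos2sin2 gerBl sqr_ge0.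
have a0 : 0 < 1 - (c * cos theta) ^+ 2 by rewrite exprMn; nra.
have b0 : 0 < 1 - ((3 * c ^+ 2 - 1) / 2) ^+ 2 by have := sqr_ge0 c; nra.
rewrite /ring_coeff balancing_massE -?exprMn ?ltW // /attraction.
have wE : `|sin (2 * theta)| ^+ 2 = 4 * cos theta ^+ 2 * (1 - cos theta ^+ 2).
  by rewrite real_normK ?num_real // sin_double !exprMn sin2cos2; ring.
set w := `|_| in wE *; have w0 : 0 <= w by exact: normr_ge0.
have aE := sqr_sqrtr (ltW a0); have bE := sqr_sqrtr (ltW b0).
rewrite -sqrtr_gt0 in a0; rewrite -sqrtr_gt0 in b0; move: a0 b0.
set a := Num.sqrt _ in aE *; set b := Num.sqrt _ in bE * => a0 b0.
have -> : 2 * - (3 * c * w ^+ 3 / (2 * cos theta * a ^+ 3)) * cos theta * a ^- 3 +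
    3 * c * b ^- 3 =
  3 * c / (a ^+ 6 * b ^+ 3) * ((a ^+ 2) ^+ 3 - (w * b) ^+ 3).
  by field; rewrite C0 !gt_eqF.
have k0 : 3 * c / (a ^+ 6 * b ^+ 3) != 0.
  by rewrite !mulf_neq0 // invr_neq0 // gt_eqF // mulr_gt0 ?exprn_gt0.
have wb0 : 0 <= w * b by rewrite mulr_ge0 // ltW.
rewrite mulf_eq0 (negPf k0) /= subr_eq0 eqrXn2 ?exprn_ge0 ?(ltW a0) //.
rewrite -(@eqrXn2 _ 2) ?exprn_ge0 ?(ltW a0) // eq_sym -subr_eq0.
rewrite exprMn wE aE bE; congr (_ == 0); rewrite /resonance; by field.
Qed.

(** * Central and special configurations of the five points *)

Lemma five_points_dot_bounds (R : realType) (r c theta : R) (i j : 'I_5) :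
  admissible R (c, theta) -> r ^+ 2 + c ^+ 2 = 1 -> i != j ->
  -1 < dot (five_points r c theta i) (five_points r c theta j) < 1.
Proof.
move=> adm rc /negPf ij; have [cC _ s0 c1] := admissible_bounds adm.
rewrite dot_five_points // ij.
have S2 : 0 < sin theta ^+ 2 by rewrite exprn_gt0.
have C2 : 0 < cos theta ^+ 2.
  by rewrite exprn_even_gt0 //=; have [] := admissible_neq0 adm.
have cs := cos2Dsin2 theta; have c2 := sqr_ge0 c.
have cCb : (c * cos theta) ^+ 2 < 1 by rewrite exprMn; nra.
have /andP[lo hi] : -1 < c * cos theta < 1.
  by rewrite -ltr_norml -(@expr_lt1 _ 2) // real_normK ?num_real.
by case: ifP => _; [|case: ifP => _]; apply/andP; split; lra.
Qed.

Lemma five_points_not_singular (R : realType) (r c theta : R) :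
  admissible R (c, theta) -> r ^+ 2 + c ^+ 2 = 1 ->
  ~ singular (five_points r c theta).
Proof.
move=> adm rc [i [j [ij]]].
have ne : i != j by apply: contraTneq ij => ->; rewrite ltnn.
have := five_points_dot_bounds adm rc ne.
by move=> /andP[lo hi] [] E; move: lo hi; rewrite E ltxx.
Qed.

Lemma five_points_force_gradient (R : realType) (r c theta m : R) (i : 'I_5) :
  admissible R (c, theta) -> r ^+ 2 + c ^+ 2 = 1 ->
  is_partial_gradient (force_function (five_masses m)) (five_points r c theta) i
    (force_gradient (five_masses m) (five_points r c theta) i).
Proof.
move=> adm rc; apply: force_gradientP => [|j ji]; first exact: on_S3_five_points.
by apply: five_points_dot_bounds => //; rewrite eq_sym.
Qed.

(** Both gradients vanish at [q_1] and [q_2], and the three vertices of the triangle all impose the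
    same scalar equation on [lambda]. *)
Lemma five_points_central_with (R : realType) (r c theta lambda : R) :
  admissible R (c, theta) -> r ^+ 2 + c ^+ 2 = 1 ->
  ring_coeff c theta (balancing_mass c theta) = lambda * - (2 * c) ->
  central_with (five_masses (balancing_mass c theta)) (five_points r c theta)
    lambda.
Proof.
move=> adm rc lamE; split.
- have m0 := balancing_mass_gt0 adm.
  by case=> -[|[|[|[|[|//]]]]] ?; rewrite /five_masses /=.
- by move=> i; exact: on_S3_five_points.
- exact: five_points_not_singular.
move=> i; do 2 eexists; split.
- exact: five_points_force_gradient.
- exact/inertia_gradientP/on_S3_five_points.
rewrite force_gradient_five // inertia_gradient_five //.
case: ifP => _; last by rewrite lamE scalerA.
by rewrite pole_coeff_balanced // mulr0 scale0r scaler0.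
Qed.

Lemma five_points_central (R : realType) (r c theta : R) :
  admissible R (c, theta) -> r ^+ 2 + c ^+ 2 = 1 ->
  central_configuration (five_masses (balancing_mass c theta))
    (five_points r c theta).
Proof.
move=> adm rc.
exists (ring_coeff c theta (balancing_mass c theta) / - (2 * c)).
apply: five_points_central_with => //; rewrite divfK // oppr_eq0 mulf_neq0 //.
by have [] := admissible_neq0 adm.
Qed.

(** Being special only says that some gradient is zero; uniqueness identifies it with the explicit
    one, whose coefficient must then vanish. *)
Lemma five_points_special (R : realType) (r c theta : R) :
  admissible R (c, theta) -> 0 < r -> r ^+ 2 + c ^+ 2 = 1 ->
  special_central_configuration (five_masses (balancing_mass c theta))
    (five_points r c theta) <-> resonance c theta = 0.
Proof.
move=> adm r0 rc; split=> [[_ _ _ grad]|/eqP]; last first.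
  rewrite -ring_coeff_balanced // => /eqP coeff0.
  by apply: five_points_central_with => //; rewrite coeff0 mul0r.
(* Index 2 is [q_3]; the x-entry of its gradient is [- c r] times the coefficient, with [c] and [r]
   nonzero. *)
pose i : 'I_5 := inord 2; have iE : i = 2%N :> nat by rewrite inordK.
have [gU [gI [gUP _ gU0]]] := grad i; rewrite gU0 scale0r in gUP.
have := sphere_gradient_unique (on_S3_five_points theta i rc) gUP
  (five_points_force_gradient _ i adm rc).
rewrite force_gradient_five // iE /= => /matrixP/(_ 0 0).
rewrite !mxE /five_points iE /= mxE /= sub0r => /esym/eqP.
have [c0 _] := admissible_neq0 adm.
rewrite mulf_eq0 oppr_eq0 (mulf_eq0 c) (negPf c0) (gt_eqF r0) !orbF.
by rewrite ring_coeff_balanced // => /eqP.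
Qed.

(** * The exceptional parameter set *)

Lemma finite_resonance (R : realType) (c : R) :
  finite_set [set theta | 0 < theta < pi /\ resonance c theta = 0].
Proof.
pose A : {poly R} := 'X^2.
pose P : {poly R} := (3 * (1 - c ^+ 2) * (1 + 3 * c ^+ 2)) *: (A * (1 - A)) -
  (1 - c ^+ 2 *: A) ^+ 2.
have PE x : P.[x] = 3 * x ^+ 2 * (1 - x ^+ 2) * (1 - c ^+ 2) * (1 + 3 * c ^+ 2) -
    (1 - c ^+ 2 * x ^+ 2) ^+ 2.
  by rewrite /P /A !(hornerD, hornerN, hornerZ, hornerM, hornerX, hornerC); ring.
have P0 : P != 0.
  apply: contra_eq_neq (PE 0) => ->; rewrite horner0 expr0n /=.
  by rewrite !(mulr0, mul0r, subr0, sub0r) expr1n eq_sym oppr_eq0 oner_eq0.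
have finB : finite_set [set x | root P x].
  (* An infinite root set would contain at least [size P] distinct roots, too many for a nonzero
     polynomial. *)
  apply: contrapT => infB; have [B BP] := infinite_set_fset (size P) infB.
  rewrite leqNgt max_poly_roots // ?finmap.fset_uniq //.
  by apply/allP => x xB; exact: BP.
(* On []0, pi[] the angle is recovered from its cosine by [acos]. *)
apply: sub_finite_set (finite_image (@acos R) finB) => theta [/andP[t0 tpi] res0].
exists (cos theta); first by rewrite /= rootE PE -/(resonance c theta) res0.
by rewrite cosK // in_itv /= !ltW.
Qed.

Lemma continuous_resonance (R : realType) :
  continuous (fun p : R * R => resonance p.1 p.2).
Proof.
move=> p; rewrite /resonance.
have c1 : {for p, continuous (fst : R * R -> R)} by exact: cvg_fst.
have c2 : {for p, continuous (fun q : R * R => cos q.2)}.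
  by apply: continuous_comp; [exact: cvg_snd|exact: continuous_cos].
have cst_ (k : R) : {for p, continuous (fun _ : R * R => k)}.
  exact: cst_continuous.
have cM (f g : R * R -> R) : {for p, continuous f} -> {for p, continuous g} ->
    {for p, continuous (fun q => f q * g q)} by move=> cf cg; exact: continuousM.
have cB (f g : R * R -> R) : {for p, continuous f} -> {for p, continuous g} ->
    {for p, continuous (fun q => f q - g q)} by move=> cf cg; exact: continuousB.
have cD (f g : R * R -> R) : {for p, continuous f} -> {for p, continuous g} ->
    {for p, continuous (fun q => f q + g q)} by move=> cf cg; exact: continuousD.
have csq (f : R * R -> R) : {for p, continuous f} ->
    {for p, continuous (fun q => f q ^+ 2)} by move=> cf; exact: cM.
apply: (cB); last by apply: (csq); apply: (cB) => //; apply: (cM); exact: csq.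
apply: (cM); last by apply: (cD) => //; apply: (cM) => //; exact: csq.
apply: (cM); last by apply: (cB) => //; exact: csq.
by apply: (cM); [apply: (cM) => //; exact: csq|apply: (cB) => //; exact: csq].
Qed.

Lemma open_admissible (R : realType) : open (admissible R).
Proof.
have open_slab (i : R * R -> R) (a b : R) : continuous i ->
    open [set p | a < i p < b].
  move=> ci.
  have -> : [set p | a < i p < b] = i @^-1` `]a, b[%classic.
    by apply/seteqP; split=> p /=; rewrite in_itv.
  by apply: open_comp => [p _|]; [exact: ci|exact: interval_open].
have cf : continuous (fst : R * R -> R) by move=> p; exact: cvg_fst.
have cs : continuous (snd : R * R -> R) by move=> p; exact: cvg_snd.
by apply: openU; apply: openI; exact: open_slab.
Qed.

Lemma measurable_resonance (R : realType) :
  measurable [set p : R * R | 0 < p.2 < pi /\ resonance p.1 p.2 = 0].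
Proof.
have -> : [set p : R * R | 0 < p.2 < pi /\ resonance p.1 p.2 = 0] =
    snd @^-1` `]0, pi[%classic `&` (fun p => resonance p.1 p.2) @^-1` [set 0].
  by apply/seteqP; split=> p /=; rewrite in_itv.
have mc : measurable_fun setT (fun p : R * R => cos p.2).
  apply: measurableT_comp => //.
  exact: continuous_measurable_fun (@continuous_cos R).
apply: measurableI; rewrite -[X in measurable X]setTI.
  exact: measurable_snd.
suff : measurable_fun setT (fun p : R * R => resonance p.1 p.2) by apply.
rewrite /resonance.
apply: measurable_funB; last first.
  apply: measurable_funX; apply: measurable_funB => //.
  by apply: measurable_funM; exact: measurable_funX.
repeat apply: measurable_funM => //; try exact: measurable_funX.
- by apply: measurable_funB => //; exact: measurable_funX.
- by apply: measurable_funB => //; exact: measurable_funX.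
- apply: measurable_funD => //.
  by apply: measurable_funM => //; exact: measurable_funX.
Qed.

Lemma negligible_resonance (R : realType) :
  (@lebesgue_measure R \x @lebesgue_measure R)%E.-negligible
    [set p : R * R | 0 < p.2 < pi /\ resonance p.1 p.2 = 0].
Proof.
apply/negligibleP; first exact: measurable_resonance.
(* The product measure integrates over [c] the measure of the section at [c], which is finite as a
   set and hence null. *)
apply: integral0_eq => c _ /=; apply: countable_lebesgue_measure0.
apply/finite_set_countable/(sub_finite_set _ (finite_resonance c)) => theta.
by rewrite /xsection /= inE.
Qed.

(** It suffices to vary [theta]: near [(c, theta)] the vertical line stays in [D], and removing
    finitely many points from it leaves [theta] a limit point. *)
Lemma dense_off_resonance (R : realType) (D : set (R * R)) : open D ->
  (forall p, D p -> 0 < p.2 < pi) ->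
  D `<=` closure (D `&` [set p | resonance p.1 p.2 != 0]).
Proof.
move=> oD Dpi [c theta] Dp B Bp.
have Dp' : nbhs (c, theta) D by exact: open_nbhs_nbhs.
have lim : limit_point setT theta.
  move=> U Uth; have : theta^' (U `&` [set y | y != theta]).
    by apply: filterI; [exact: nbhs_dnbhs|exact: withinT].
  by move=> /filter_ex[y [Uy yt]]; exists y.
have pc : (fun t : R => (c, t)) @ theta --> (c, theta).
  exact: (@cvg_pair _ _ _ _ (nbhs c) (nbhs theta) _ _ _ (fun=> c) id (cvg_cst c)
            (@cvg_id _ _)).
have nb : nbhs theta ((fun t : R => (c, t)) @^-1` (D `&` B)).
  have DB : nbhs (c, theta) (D `&` B) by exact: filterI.
  exact: (pc _ DB).
have [t [_ [_ nres] [Dt Bt]]] := limit_point_setD (finite_resonance c) lim nb.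
exists (c, t); split => //; split => //=.
apply/eqP => res0; apply: nres; split => //.
exact: Dpi Dt.
Qed.

(** * Centrality for all parameters and ordinariness for generic ones *)

Theorem proposition2 (R : realType) :
  (forall c theta r m : R,
     admissible R (c, theta) -> 0 < r -> r ^+ 2 + c ^+ 2 = 1 ->
     m = balancing_mass c theta ->
     central_configuration (five_masses m) (five_points r c theta))
  /\
  generically_in (admissible R)
    [set p : R * R | forall r m : R,
       0 < r -> r ^+ 2 + p.1 ^+ 2 = 1 -> m = balancing_mass p.1 p.2 ->
       ordinary_central_configuration (five_masses m) (five_points r p.1 p.2)].
Proof.
split=> [c theta r m adm _ rc ->|]; first exact: five_points_central.
set Q := [set p | _].
(* Inside the domain, being ordinary is the condition that [resonance] is nonzero, which is visibly
   open. *)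
have DQ : admissible R `&` Q =
    admissible R `&` [set p | resonance p.1 p.2 != 0].
  apply/seteqP; split=> -[c theta] [adm /= h]; split => //=.
    have [_ _ _ c1] := admissible_bounds adm.
    (* [Q] quantifies over [r], so it is instantiated at the positive solution of
       [r^2 + c^2 = 1]. *)
    have r0 : 0 < Num.sqrt (1 - c ^+ 2) by rewrite sqrtr_gt0 subr_gt0.
    have rc : Num.sqrt (1 - c ^+ 2) ^+ 2 + c ^+ 2 = 1.
      by rewrite sqr_sqrtr ?subr_ge0 ?ltW // subrK.
    have [_ nspecial] := h _ _ r0 rc erefl.
    by apply/eqP => res0; apply: nspecial; exact/five_points_special.
  move=> r m r0 rc ->; split; first exact: five_points_central.
  by move=> /(five_points_special adm r0 rc)/eqP; exact/negP.
have adm_pi p : admissible R p -> 0 < p.2 < pi.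
  by case: p => c theta /admissible_bounds[].
split.
- rewrite DQ; apply: openI; first exact: open_admissible.
  apply: (@open_comp _ _ (fun p : R * R => resonance p.1 p.2) [set x | x != 0]).
    by move=> p _; exact: continuous_resonance.
  exact: open_neq.
- by rewrite DQ; apply: dense_off_resonance => //; exact: open_admissible.
- apply: negligibleS (@negligible_resonance R) => p [adm nQ].
  split; first exact: adm_pi.
  apply: contrapT => /eqP res; apply: nQ.
  by have [] : (admissible R `&` Q) p by rewrite DQ.
Qed.
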